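(* There are, up to isomorphism, only finitely many excluded minors for the class of bicircular matroids that have rank less than ten.
   Context: All graphs and matroids are finite; graphs may have loops and multiple edges. The bicycles of a graph $G=(V,E)$ are the subgraphs of $G$ that are minimal with respect to having more edges than vertices. The bicircular matroid $B(G)$ is the matroid on ground set $E$ whose circuits are the edge sets of the bicycles of $G$. A loopless matroid is bicircular if it is isomorphic to $B(G)$ for some graph $G$. So that the class is minor-closed, loops are allowed: a general matroid is bicircular if deleting all its loops yields a matroid isomorphic to $B(G)$ for some graph $G$. An excluded minor for the class of bicircular matroids is a matroid that is not bicircular but all of whose proper minors are bicircular. *)

(* Defs.v *)
From mathcomp Require Import all_boot.

Set Implicit Arguments.
Unset Strict Implicit.
Unset Printing Implicit Defensive.

(** The ground set of a matroid is a whole finite type; minors live on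
    subtypes. *)
Record matroid := Matroid {
  ground :> finType;
  indep : {set {set ground}};
  indep0 : set0 \in indep;
  indepS : forall I J : {set ground},
    I \subset J -> J \in indep -> I \in indep;
  indep_augment : forall I J : {set ground},
    I \in indep -> J \in indep -> #|I| < #|J| ->
    exists2 x, x \in J :\: I & x |: I \in indep }.

Arguments indep : clear implicits.

Definition rank (M : matroid) : nat := \max_(I in indep M) #|I|.

Definition circuit (M : matroid) (C : {set M}) : bool :=
  minset [pred X | X \notin indep M] C.

Definition isomorphic (M N : matroid) : Prop :=
  exists2 f : M -> N, bijective f &
    forall I : {set M}, (f @: I \in indep N) = (I \in indep M).

Definition basis_of (M : matroid) (X B : {set M}) : bool :=
  maxset [pred I : {set M} | (I \in indep M) && (I \subset X)] B.

Lemma basis_exists (M : matroid) (X : {set M}) : exists B, basis_of X B.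
Proof.
have P0 : (set0 \in indep M) && (set0 \subset X) by rewrite indep0 sub0set.
have [B maxB _] := @maxset_exists _
  [pred I : {set M} | (I \in indep M) && (I \subset X)] set0 P0.
by exists B.
Qed.

Lemma basis_extend (M : matroid) (X B : {set M}) (x : M) :
  basis_of X B -> x \in X -> x \notin B -> x |: B \notin indep M.
Proof.
move=> /maxsetP[/= /andP[_ sBX] maxB] xX xB; apply/negP=> ixB.
have P : (x |: B \in indep M) && (x |: B \subset X).
  by rewrite ixB subUset sub1set xX sBX.
by move: xB; rewrite -(maxB _ P (subsetUr _ _)) setU11.
Qed.

Lemma leq_basis (M : matroid) (X B B' : {set M}) :
  basis_of X B -> basis_of X B' -> #|B'| <= #|B|.
Proof.
move=> bB bB'; rewrite leqNgt; apply/negP=> ltBB'.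
case/maxsetP: (bB) => /= /andP[iB _] _.
case/maxsetP: (bB') => /= /andP[iB' sB'X] _.
have [x /setDP[xB' xB] ixB] := indep_augment iB iB' ltBB'.
by move: (basis_extend bB (subsetP sB'X x xB') xB); rewrite ixB.
Qed.

Section Minor.
Variables (M : matroid) (C D : {set M}).

Definition minor_ground : finType := {x : M | x \notin C :|: D}.

Definition minor_indep : {set {set minor_ground}} :=
  [set I : {set minor_ground} |
    [exists B : {set M}, basis_of C B && (val @: I :|: B \in indep M)]].

Lemma minor_indep0 : set0 \in minor_indep.
Proof.
have [B bB] := basis_exists C; rewrite inE; apply/existsP; exists B.
by rewrite bB imset0 set0U; case/maxsetP: bB => /= /andP[].
Qed.

Lemma minor_indepS (I J : {set minor_ground}) :
  I \subset J -> J \in minor_indep -> I \in minor_indep.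
Proof.
move=> sIJ; rewrite !inE => /existsP[B /andP[bB iJ]].
apply/existsP; exists B; rewrite bB; apply: indepS iJ.
exact: setSU (imsetS _ sIJ).
Qed.

Lemma card_minorU (I : {set minor_ground}) (B : {set M}) :
  basis_of C B -> #|val @: I :|: B| = #|I| + #|B|.
Proof.
case/maxsetP=> /= /andP[_ sBC] _.
rewrite cardsU card_imset; last exact: val_inj.
suff -> : val @: I :&: B = set0 by rewrite cards0 subn0.
apply/setP=> y; rewrite !inE; apply/andP=> -[/imsetP[x _ ->] xB].
by move: (valP x); rewrite inE (subsetP sBC _ xB).
Qed.

Lemma minor_indep_augment (I J : {set minor_ground}) :
  I \in minor_indep -> J \in minor_indep -> #|I| < #|J| ->
  exists2 x, x \in J :\: I & x |: I \in minor_indep.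
Proof.
rewrite inE => /existsP[B /andP[bB iI]].
rewrite inE => /existsP[B' /andP[bB' iJ]] ltIJ.
have lt : #|val @: I :|: B| < #|val @: J :|: B'|.
  by rewrite !card_minorU // -addSn leq_add // (leq_basis bB' bB).
have [y /setDP[yJ yI] iy] := indep_augment iI iJ lt.
move: yI; rewrite inE negb_or => /andP[yI yB].
case/setUP: yJ => [/imsetP[x xJ def_y]|yB'].
  subst y; exists x.
    by rewrite inE xJ andbT; apply: contra yI; apply: imset_f.
  by rewrite inE; apply/existsP; exists B; rewrite bB imsetU1 -setUA.
have sB'C : B' \subset C by case/maxsetP: bB' => /= /andP[].
case/negP: (basis_extend bB (subsetP sB'C y yB') yB).
by apply: indepS iy; rewrite setUS // subsetUr.
Qed.

(** The minor M / C \ D: a set is independent in M / C when its union with a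
    basis of C is independent in M. *)
Definition minor : matroid :=
  Matroid minor_indep0 minor_indepS minor_indep_augment.

End Minor.

Definition delete (M : matroid) (D : {set M}) : matroid := minor set0 D.

Lemma indep_delete (M : matroid) (D : {set M}) (I : {set delete D}) :
  (I \in indep (delete D)) = (val @: I \in indep M).
Proof.
rewrite inE; apply/existsP/idP => [[B /andP[_]]|iI].
  by apply: indepS; rewrite subsetUl.
exists set0; rewrite setU0 iI andbT; apply/maxsetP; split=> /=.
  by rewrite indep0 sub0set.
by move=> B /andP[_]; rewrite subset0 => /eqP.
Qed.

Section MatroidOfCircuits.
Variables (T : finType) (circ : pred {set T}).
Hypothesis circ0 : ~~ circ set0.
Hypothesis circ_incomp : forall C1 C2,
  circ C1 -> circ C2 -> C1 \subset C2 -> C1 = C2.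
Hypothesis circ_elim : forall C1 C2 e, circ C1 -> circ C2 -> C1 != C2 ->
  e \in C1 :&: C2 -> exists2 C3, circ C3 & C3 \subset (C1 :|: C2) :\ e.

Definition free : {set {set T}} :=
  [set I : {set T} | [forall C : {set T}, circ C ==> ~~ (C \subset I)]].

Lemma freeP (I : {set T}) :
  reflect (forall C, circ C -> ~~ (C \subset I)) (I \in free).
Proof. by rewrite inE; apply: (iffP forall_inP). Qed.

Lemma freePn (I : {set T}) :
  I \notin free -> exists2 C, circ C & C \subset I.
Proof.
rewrite inE negb_forall => /existsP[C].
by rewrite negb_imply negbK => /andP[]; exists C.
Qed.

Lemma free0 : set0 \in free.
Proof.
apply/freeP=> C circC; apply: contra circ0.
by rewrite subset0 => /eqP <-.
Qed.

Lemma freeS (I J : {set T}) : I \subset J -> J \in free -> I \in free.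
Proof.
move=> sIJ /freeP fJ; apply/freeP=> C cC.
by apply: contra (fJ C cC) => /subset_trans; apply.
Qed.

Lemma free_augment (I J : {set T}) :
  I \in free -> J \in free -> #|I| < #|J| ->
  exists2 x, x \in J :\: I & x |: I \in free.
Proof.
move=> fI fJ ltIJ.
pose P (K : {set T}) := [&& K \in free, #|I| < #|K| & K \subset I :|: J].
have PJ : P J by rewrite /P fJ ltIJ subsetUr.
case: (arg_minnP (fun K : {set T} => #|I :\: K|) PJ).
move=> K /and3P[fK ltIK sK] minK.
have [sIK|nsIK] := boolP (I \subset K).
  have : I \proper K by rewrite properEcard sIK.
  case/properP=> _ [x xK xI]; exists x.
    rewrite inE xI; move: (subsetP sK x xK).
    by rewrite inE (negPf xI).
  by apply: freeS fK; rewrite subUset sub1set xK.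
have /subsetPn[e eI eK] := nsIK.
have circF f : f \in K :\: I ->
    exists C, [/\ circ C, C \subset (e |: K) :\ f & e \in C].
  case/setDP=> fK' fI'.
  have fe : e != f by apply: contraNneq eK => ->.
  have /freePn[C cC sC] : (e |: K) :\ f \notin free.
    apply/negP=> fT.
    have : #|I :\: K| <= #|I :\: ((e |: K) :\ f)|.
      apply: minK; apply/and3P; split=> //.
        move: (cardsD1 f (e |: K)); rewrite cardsU1 eK in_setU1 fK' orbT.
        by move/eqP; rewrite eqn_add2l => /eqP <-.
      apply: subset_trans (subD1set _ _) _.
      by rewrite subUset sub1set inE eI sK.
    rewrite leqNgt => /negP; apply; apply: proper_card; apply/properP; split.
      apply/subsetP=> x; rewrite !inE negb_and negb_or negbK.
      case/andP=> /orP[/eqP->|/andP[_ ->] -> //].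
      by rewrite (negPf fI').
    by exists e; rewrite !inE ?eI ?eK // fe eqxx.
  exists C; split=> //; apply: contraLR (freeP _ fK C cC) => eC.
  rewrite negbK; apply/subsetP=> x xC; move: (subsetP sC x xC).
  by rewrite !inE => /andP[_ /orP[/eqP xe|//]]; rewrite -xe xC in eC.
have /subsetPn[g gK gI] : ~~ (K \subset I).
  by apply: contraL ltIK => /subset_leq_card; rewrite leqNgt.
have [|Cg [cCg sCg eCg]] := circF g; first by rewrite inE gI.
have /subsetPn[h hCg hI] := freeP _ fI Cg cCg.
have hK : h \in K.
  move: (subsetP sCg h hCg); rewrite !inE => /andP[_ /orP[/eqP he|//]].
  by rewrite he eI in hI.
have [|Ch [cCh sCh eCh]] := circF h; first by rewrite inE hI.
have neC : Cg != Ch.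
  apply: contraTneq hCg => ->; apply/negP=> /(subsetP sCh).
  by rewrite !inE eqxx.
have [|C3 cC3 sC3] := circ_elim cCg cCh neC (e := e).
  by rewrite inE eCg.
case/negP: (freeP _ fK C3 cC3); apply: subset_trans sC3 _.
apply/subsetP=> x; rewrite !inE => /andP[xe /orP[/(subsetP sCg)|/(subsetP sCh)]];
  by rewrite !inE (negPf xe) => /andP[].
Qed.

Definition matroid_of_circuits : matroid :=
  Matroid free0 freeS free_augment.

Lemma circuit_matroid_of_circuits (C : {set T}) :
  @circuit matroid_of_circuits C = circ C.
Proof.
apply/minsetP/idP => [[/= /freePn[C' cC' sC'] minC]|cC].
  rewrite -(minC C') //=; apply/negP=> /freeP/(_ C' cC').
  by rewrite subxx.
split=> [|X /= /freePn[C' cC' sC'X] sXC].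
  by apply/negP=> /freeP/(_ C cC); rewrite subxx.
apply/eqP; rewrite eqEsubset sXC.
by rewrite -(circ_incomp cC' cC (subset_trans sC'X sXC)).
Qed.

End MatroidOfCircuits.

(** An edge is a loop when its set of ends is a singleton. *)
Record graph := Graph {
  vertex : finType;
  edge : finType;
  ends : edge -> {set vertex};
  ends_card : forall e, 0 < #|ends e| <= 2 }.

Arguments ends : clear implicits.

Section Bicycles.
Variable G : graph.
Implicit Types (H K : {set vertex G} * {set edge G}).

(** A subgraph is given by its vertex set and its edge set. *)
Definition subgraph H : bool := [forall e in H.2, ends G e \subset H.1].

Definition subgraph_le H K : bool := (H.1 \subset K.1) && (H.2 \subset K.2).

Definition excess H : bool := subgraph H && (#|H.1| < #|H.2|).

Definition bicycle H : bool :=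
  excess H && [forall K, excess K && subgraph_le K H ==> (K == H)].

Definition bicycle_edges (F : {set edge G}) : bool :=
  [exists W, bicycle (W, F)].

Lemma bicycleP H :
  reflect (excess H /\ forall K, excess K -> subgraph_le K H -> K = H)
          (bicycle H).
Proof.
apply: (iffP andP) => -[eH minH]; split=> //.
  by move=> K eK sKH; apply/eqP; apply: (implyP (forallP minH K)); apply/andP.
by apply/forallP=> K; apply/implyP=> /andP[eK sKH]; apply/eqP/minH.
Qed.

Lemma subgraph_le_refl H : subgraph_le H H.
Proof. by rewrite /subgraph_le !subxx. Qed.

Lemma subgraph_le_trans H K L :
  subgraph_le H K -> subgraph_le K L -> subgraph_le H L.
Proof.
move=> /andP[a b] /andP[c d]; rewrite /subgraph_le.
by rewrite (subset_trans a c) (subset_trans b d).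
Qed.

Lemma excess_bicycle H :
  excess H -> exists2 K, bicycle K & subgraph_le K H.
Proof.
move=> eH; pose P K := excess K && subgraph_le K H.
have PH : P H by rewrite /P eH subgraph_le_refl.
case: (arg_minnP (fun K => #|K.1| + #|K.2|) PH) => K /andP[eK sKH] minK.
exists K => //; apply/bicycleP; split=> // L eL sLK.
have PL : P L by rewrite /P eL (subgraph_le_trans sLK sKH).
have := minK L PL; case/andP: sLK => s1 s2.
have [l1 l2] := (subset_leq_card s1, subset_leq_card s2) => le.
have c1 : #|K.1| <= #|L.1|.
  by rewrite -(leq_add2r #|K.2|) (leq_trans le) // leq_add2l.
have c2 : #|K.2| <= #|L.2|.
  by rewrite -(leq_add2l #|K.1|) (leq_trans le) // leq_add2r.
rewrite [L]surjective_pairing [K]surjective_pairing.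
by congr (_, _); apply/eqP; rewrite eqEcard ?s1 ?s2.
Qed.

Lemma bicycle_vertices H :
  bicycle H -> H.1 = \bigcup_(e in H.2) ends G e.
Proof.
case/bicycleP=> /andP[/forall_inP sH ltH] minH.
set W := \bigcup_(e in _) _.
have sW : W \subset H.1 by apply/bigcupsP.
suff /(congr1 fst) /= <- : (W, H.2) = H by [].
apply: minH; last by rewrite /subgraph_le /= sW subxx.
apply/andP; split=> /=; last exact: leq_ltn_trans (subset_leq_card sW) ltH.
by apply/forall_inP=> e eH; apply: (bigcup_sup e).
Qed.

Lemma bicycle_edges0 : ~~ bicycle_edges set0.
Proof.
by apply/existsP=> -[W /bicycleP[/andP[_] /=]]; rewrite cards0.
Qed.

Lemma bicycle_edges_incomp F1 F2 :
  bicycle_edges F1 -> bicycle_edges F2 -> F1 \subset F2 -> F1 = F2.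
Proof.
move=> /existsP[W1 b1] /existsP[W2 b2] sF.
have /bicycleP[e1 _] := b1; have /bicycleP[_ min2] := b2.
have /= w1 := bicycle_vertices b1; have /= w2 := bicycle_vertices b2.
suff /(congr1 snd) : (W1, F1) = (W2, F2) by [].
apply: min2 => //; rewrite /subgraph_le /= sF andbT w1 w2.
by apply/bigcupsP=> e eF; apply: (bigcup_sup e) => //; apply: (subsetP sF).
Qed.

Lemma bicycle_edges_elim F1 F2 e :
  bicycle_edges F1 -> bicycle_edges F2 -> F1 != F2 -> e \in F1 :&: F2 ->
  exists2 F3, bicycle_edges F3 & F3 \subset (F1 :|: F2) :\ e.
Proof.
move=> c1 c2 neF eF.
have nsF : ~~ (F1 \subset F2).
  by apply: contra neF => /(bicycle_edges_incomp c1 c2) ->.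
have /existsP[W1 /bicycleP[e1 min1]] := c1.
have /existsP[W2 /bicycleP[e2 _]] := c2.
case/andP: e1 => /= /forall_inP /= s1 lt1.
case/andP: e2 => /= /forall_inP /= s2 lt2.
have leI : #|F1 :&: F2| <= #|W1 :&: W2|.
  rewrite leqNgt; apply: contra nsF => lt.
  suff /(congr1 snd) /= <- : (W1 :&: W2, F1 :&: F2) = (W1, F1).
    exact: subsetIr.
  apply: min1; last by rewrite /subgraph_le /= !subsetIl.
  apply/andP; split=> //=; apply/forall_inP=> x /= /setIP[x1 x2].
  by rewrite subsetI s1 ?s2.
have [|[W3 F3] b3 /andP[/= _ sF3]] :=
    @excess_bicycle (W1 :|: W2, (F1 :|: F2) :\ e).
  apply/andP; split=> /=.
    apply/forall_inP=> x /= /setD1P[_ /setUP[x1|x2]].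
      by rewrite (subset_trans (s1 x x1)) ?subsetUl.
    by rewrite (subset_trans (s2 x x2)) ?subsetUr.
  have eU : e \in F1 :|: F2 by rewrite inE; case/setIP: eF => ->.
  have := cardsD1 e (F1 :|: F2); rewrite eU add1n => cU.
  rewrite -ltnS -cU -(ltn_add2r #|F1 :&: F2|) cardsUI.
  apply: (@leq_trans (#|W1| + #|W2|).+2); last first.
    by have := leq_add lt1 lt2; rewrite addSn addnS.
  by rewrite -cardsUI addSn !ltnS leq_add2l.
by exists F3 => //; apply/existsP; exists W3.
Qed.

Definition bicircular_matroid : matroid :=
  matroid_of_circuits bicycle_edges0 bicycle_edges_elim.

Lemma circuit_bicircular_matroid (F : {set edge G}) :
  @circuit bicircular_matroid F = bicycle_edges F.
Proof. exact/circuit_matroid_of_circuits/bicycle_edges_incomp. Qed.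

End Bicycles.

Definition loops (M : matroid) : {set M} := [set x | circuit [set x]].

Definition bicircular (M : matroid) : Prop :=
  exists G : graph, isomorphic (delete (loops M)) (bicircular_matroid G).

Definition excluded_minor (M : matroid) : Prop :=
  ~ bicircular M /\
  forall C D : {set M}, [disjoint C & D] -> C :|: D != set0 ->
    bicircular (minor C D).

(* Main.v *)
Require Import Defs.
From mathcomp Require Import all_boot perm.

Set Implicit Arguments.
Unset Strict Implicit.
Unset Printing Implicit Defensive.

(** An excluded minor of rank [r] has a bounded number of elements, for every
    [r].  Bicircular independence is Hall's condition for the end-sets of the
    edges, the matroid loops being the elements with no end.  A minimal set of
    edges covering the non-isolated vertices is independent, so at most [2r]
    vertices are not isolated and there are at most [4^r] end-sets.  If [M] is
    large, then for any [e] many elements have equal end-sets both in a graph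
    for [M \ e] and in a graph for [M / e]; these elements are clones in [M].
    Let [e'] be one of them.  More than [r] of the others have a common end-set
    in a graph for [M \ e'], and giving that end-set to [e'] represents [M]:
    a set of at most [r] elements containing [e'] misses one of these clones,
    for which [e'] can be exchanged. *)

Lemma imset_val_preimset (T : finType) (P : pred T) (I : {set T}) :
  {in I, forall x, P x} ->
  val @: (val @^-1: I : {set {x | P x}}) = I.
Proof.
move=> sIP; apply/setP=> x; apply/imsetP/idP=> [[y + ->]|xI].
  by rewrite inE.
by exists (Sub x (sIP x xI)); rewrite ?inE SubK.
Qed.

(** * Hall's condition for families of end-sets *)

Section Sparse.
Variables (T V : finType) (a : T -> {set V}).

(** Hall's condition for [a] on [I]; an element with an empty end-set lies in no such [I]. *)
Definition sparse (I : {set T}) : bool :=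
  [forall F : {set T}, (F \subset I) ==> (#|F| <= #|\bigcup_(x in F) a x|)].

Lemma sparseP (I : {set T}) :
  reflect (forall F : {set T}, F \subset I -> #|F| <= #|\bigcup_(x in F) a x|)
          (sparse I).
Proof. exact: (iffP forall_inP). Qed.

Lemma sparse_neq0 (I : {set T}) x : sparse I -> x \in I -> a x != set0.
Proof.
move=> /sparseP/(_ [set x]) + xI; rewrite sub1set => /(_ xI).
by rewrite big_set1 cards1 card_gt0.
Qed.

(** Private vertices are distinct representatives for a minimal cover, so the cover is sparse: it
    has at most [r] members, each with at most two vertices. *)
Lemma sparse_support (r : nat) :
  (forall x, #|a x| <= 2) -> (forall I, sparse I -> #|I| <= r) ->
  #|\bigcup_x a x| <= 2 * r.
Proof.
move=> a2 sparse_r; set W := \bigcup_x a x.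
pose cover (F : {set T}) := W \subset \bigcup_(x in F) a x.
have coverT : cover setT.
  by rewrite /cover /W; apply/bigcupsP=> x _; apply: (bigcup_sup x); rewrite ?inE.
have [F /minsetP[/= cF minF] _] := minset_exists coverT.
(* by minimality each element of [F] has a private vertex *)
have priv x : x \in F -> exists v, (v \in a x) &&
    [forall y in F, (v \in a y) ==> (y == x)].
  move=> xF; have : ~~ cover (F :\ x).
    apply: contraL xF => cFx; rewrite -(minF _ cFx (subD1set _ _)).
    by rewrite !inE eqxx.
  case/subsetPn=> v /(subsetP cF)/bigcupP[y yF vy] vNF.
  have only z : z \in F -> v \in a z -> z = x.
    move=> zF vz; apply/eqP; apply: contraR vNF => zx; apply/bigcupP.
    by exists z => //; rewrite !inE zx.
  exists v; rewrite -{1}(only y yF vy) vy.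
  by apply/forall_inP=> z zF; apply/implyP=> /(only z zF)/eqP.
have sF : sparse F.
  apply/sparseP=> H sHF.
  have [->|[x0 x0H]] := set_0Vmem H; first by rewrite cards0.
  have [v0 _] := priv x0 (subsetP sHF _ x0H).
  (* [v0] is only a default value: every element of [F] has a private vertex. *)
  pose p x := odflt v0 [pick v | (v \in a x) &&
    [forall y in F, (v \in a y) ==> (y == x)]].
  have pP x : x \in F ->
      p x \in a x /\ forall y, y \in F -> p x \in a y -> y = x.
    move=> xF; rewrite /p; case: pickP => [v /andP[vx /forall_inP h]|h] /=.
      by split=> // y yF vy; apply/eqP; apply: (implyP (h y yF)).
    by have [v] := priv x xF; rewrite h.
  have injp : {in H &, injective p}.
    move=> x y /(subsetP sHF) xF /(subsetP sHF) yF pxy.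
    have [_ h] := pP y yF; apply: h => //.
    by rewrite -pxy; case: (pP x xF).
  rewrite -(card_in_imset injp); apply/subset_leq_card.
  apply/subsetP=> _ /imsetP[x xH ->].
  by apply/bigcupP; exists x => //; case: (pP x (subsetP sHF _ xH)).
apply: leq_trans (subset_leq_card cF) _.
apply: (@leq_trans (\sum_(x in F) #|a x|)).
  elim/big_rec2: _ => [|x n A _ le]; first by rewrite cards0.
  by apply: leq_trans (leq_card_setU _ _) _; rewrite leq_add2l.
apply: (@leq_trans (\sum_(x in F) 2)); first exact: leq_sum.
by rewrite sum_nat_const mulnC leq_mul2l sparse_r.
Qed.

(** Pigeonhole: end-sets are subsets of the support, whose at most [2 * r] vertices have at most
    [4 ^ r] subsets. *)
Lemma sparse_many_equal (r m : nat) (X : {set T}) :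
  (forall x, #|a x| <= 2) -> (forall I, sparse I -> #|I| <= r) ->
  4 ^ r * m < #|X| ->
  exists A, m < #|[set x in X | a x == A]|.
Proof.
move=> a2 sparse_r ltX.
suff /existsP[A ltA] : [exists A, m < #|[set x in X | a x == A]|] by exists A.
apply: contraLR ltX => /existsPn noA; rewrite -leqNgt.
set W := \bigcup_x a x.
have aW x : a x \in powerset W by rewrite inE; apply: (bigcup_sup x).
rewrite -sum1_card (partition_big a (mem (powerset W))) //=.
apply: (@leq_trans (\sum_(A in powerset W) m)).
  apply: leq_sum => A _; apply: leq_trans (_ : _ <= #|[set x in X | a x == A]|) _.
    by rewrite sum1_card; apply/subset_leq_card/subsetP=> x; rewrite !inE.
  by rewrite leqNgt noA.
rewrite sum_nat_const card_powerset leq_mul2r; apply/orP; right.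
by rewrite -[4]/(2 ^ 2) -expnM leq_exp2l // sparse_support.
Qed.

End Sparse.

Lemma eq_in_sparse (T V : finType) (a b : T -> {set V}) (I : {set T}) :
  {in I, a =1 b} -> sparse a I = sparse b I.
Proof.
move=> eqab; apply: eq_forallb => F; case sFI: (F \subset I) => //=.
by congr (_ <= #|pred_of_set _|); apply: eq_bigr => x /(subsetP sFI)/eqab.
Qed.

(** Serves for [val], for isomorphisms and for transpositions. *)
Lemma sparse_comp (S T V : finType) (a : T -> {set V}) (f : S -> T)
    (I : {set S}) :
  injective f -> sparse (a \o f) I = sparse a (f @: I).
Proof.
move=> injf.
have bigE (F : {set S}) :
    \bigcup_(x in f @: F) a x = \bigcup_(x in F) (a \o f) x.
  by rewrite big_imset //= => x y _ _ /injf.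
apply/sparseP/sparseP => h F sF; last first.
  by rewrite -bigE -(card_imset _ injf); apply: h; apply: imsetS.
have -> : F = f @: (f @^-1: F).
  apply/setP=> x; apply/idP/imsetP=> [xF|[y + ->]]; last by rewrite inE.
  by have /imsetP[y _ def_x] := subsetP sF x xF; exists y; rewrite ?inE -?def_x.
rewrite bigE card_imset //; apply: h; apply/subsetP=> x; rewrite inE.
by move=> /(subsetP sF)/imsetP[y yI /injf ->].
Qed.

(** * Representations by end-sets, with empty end-sets for loops *)

Section Extension.
Variables (T V : finType) (P : pred T) (a : {x | P x} -> {set V}).

(** Lets families for minors live on the ground set of the whole matroid. *)
Definition extend_by_loops (x : T) : {set V} := oapp a set0 (insub x).

Lemma extend_by_loops_val x : extend_by_loops (val x) = a x.
Proof. by rewrite /extend_by_loops valK. Qed.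

Lemma card_extend_by_loops x :
  (forall y, #|a y| <= 2) -> #|extend_by_loops x| <= 2.
Proof.
by rewrite /extend_by_loops => a2; case: insub => [y|] /=; rewrite ?cards0.
Qed.

Lemma sparse_extend_by_loops (I : {set T}) :
  sparse extend_by_loops I =
  [forall x in I, P x] && sparse a (val @^-1: I).
Proof.
have E : {in I, forall x, P x} ->
    sparse extend_by_loops I = sparse a (val @^-1: I).
  move=> IP; rewrite -{1}(imset_val_preimset IP) -sparse_comp;
    last exact: val_inj.
  by apply: eq_in_sparse => x _; apply: extend_by_loops_val.
case: forall_inP => [IP|nIP] /=; first exact: E.
apply/negP=> sI; apply: nIP => x /(sparse_neq0 sI).
by rewrite /extend_by_loops; case: insubP => //=; rewrite eqxx.
Qed.

End Extension.

(** Unlike in [graph], an end-set may be empty; this happens exactly at the loops. *)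
Definition represents (M : matroid) (V : finType) (a : M -> {set V}) : Prop :=
  (forall x, #|a x| <= 2) /\ forall I : {set M}, (I \in indep M) = sparse a I.

(** A set violating Hall's condition, taken with its ends, has excess and so contains a bicycle;
    conversely, the vertices of a bicycle are exactly the ends of its edges. *)
Lemma indep_bicircular_matroid (G : graph) (I : {set bicircular_matroid G}) :
  (I \in indep (bicircular_matroid G)) = sparse (ends G) I.
Proof.
apply/idP/sparseP => [/freeP fI F sFI|h].
  rewrite leqNgt; apply/negP=> lt.
  have [|[W H] bH /andP[_ /= sH]] :=
    @excess_bicycle G (\bigcup_(x in F) ends G x, F).
    rewrite /excess /= lt andbT; apply/forall_inP=> e eF /=.
    exact: (bigcup_sup e).
  have : bicycle_edges H by apply/existsP; exists W.
  by move/fI; rewrite (subset_trans sH sFI).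
apply/freeP=> F /existsP[W bF]; apply/negP=> /h; rewrite leqNgt.
have /= <- := bicycle_vertices bF.
by case/bicycleP: bF => /andP[_ /= ->].
Qed.

Lemma loopsP (M : matroid) x : (x \in loops M) = ([set x] \notin indep M).
Proof.
rewrite inE; apply/minsetP/idP => [[] //|/= dx]; split=> //= Y dY.
rewrite subset1 => /orP[/eqP //|/eqP Y0].
by rewrite Y0 indep0 in dY.
Qed.

Lemma bicircular_represents (M : matroid) :
  bicircular M -> exists (V : finType) (a : M -> {set V}), represents a.
Proof.
case=> G [f /bij_inj injf isof].
exists (vertex G), (extend_by_loops (ends G \o f)); split=> [x|I].
  by apply: card_extend_by_loops => y; case/andP: (ends_card (f y)).
rewrite sparse_extend_by_loops sparse_comp // -indep_bicircular_matroid isof.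
have [IP|nIP] /= := forall_inP.
  by rewrite indep_delete imset_val_preimset.
apply/negP=> iI; apply: nIP => x xI; rewrite set0U loopsP negbK.
by apply: indepS iI; rewrite sub1set.
Qed.

(** Deleting the loops leaves only non-empty end-sets, which form a graph. *)
Lemma represents_bicircular (M : matroid) (V : finType) (a : M -> {set V}) :
  represents a -> bicircular M.
Proof.
move=> [a2 indepE].
have endsP (x : delete (loops M)) : 0 < #|a (val x)| <= 2.
  rewrite a2 andbT card_gt0; apply: (@sparse_neq0 _ _ a [set val x]).
    by rewrite -indepE; have := valP x; rewrite /= in_setU in_set0 loopsP negbK.
  exact: set11.
exists (Graph endsP); exists id; first by exists id.
move=> I; rewrite imset_id indep_bicircular_matroid indep_delete indepE.
by rewrite -sparse_comp //; apply: val_inj.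
Qed.

(** * Minors expressed on the ground set of the matroid *)

Lemma minor_represents (M : matroid) (C D : {set M}) :
  bicircular (minor C D) ->
  exists (V : finType) (a : M -> {set V}), (forall x, #|a x| <= 2) /\
    forall I, sparse a I =
      [disjoint I & C :|: D] && (val @^-1: I \in indep (minor C D)).
Proof.
case/bicircular_represents=> V [a [a2 indepE]].
exists V, (extend_by_loops a); split=> [x|I]; first exact: card_extend_by_loops.
rewrite sparse_extend_by_loops indepE; congr (_ && _).
by apply/forall_inP/pred0P => [h x|h x xI] /=;
  [apply/andP=> -[/h /negP] | move: (h x); rewrite /= xI /= => ->].
Qed.

Lemma leq_rank (M : matroid) (I : {set M}) : I \in indep M -> #|I| <= rank M.
Proof. by move=> iI; apply: (@leq_bigmax_cond _ _ (fun I : {set M} => #|I|)). Qed.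

Lemma minor_indep_disjoint (M : matroid) (C D I : {set M}) :
  [disjoint I & C :|: D] -> val @^-1: I \in indep (minor C D) ->
  exists2 B, basis_of C B & I :|: B \in indep M.
Proof.
move=> dI; rewrite inE => /existsP[B /andP[bB]].
rewrite imset_val_preimset => [iI|x xI]; first by exists B.
by rewrite /= (disjointFr dI xI).
Qed.

(** Independent sets of a minor are independent in [M], so [rank M] can serve as [r] in
    [sparse_many_equal]. *)
Lemma sparse_minor_rank (M : matroid) (C D : {set M}) (V : finType)
    (a : M -> {set V}) :
  (forall I, sparse a I =
    [disjoint I & C :|: D] && (val @^-1: I \in indep (minor C D))) ->
  forall I, sparse a I -> #|I| <= rank M.
Proof.
move=> aE I; rewrite aE => /andP[dI /(minor_indep_disjoint dI)[B _ iIB]].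
by apply: leq_rank; apply: indepS iIB; apply: subsetUl.
Qed.

Lemma indep_minor_delete1 (M : matroid) (e : M) (I : {set M}) :
  e \notin I -> (I \in indep M) =
  [disjoint I & set0 :|: [set e]] && (val @^-1: I \in indep (minor set0 [set e])).
Proof.
move=> eI.
have dI : [disjoint I & set0 :|: [set e]].
  by rewrite set0U disjoint_sym disjoints1.
rewrite dI (indep_delete (D := [set e])) imset_val_preimset // => x xI.
by rewrite /= (disjointFr dI xI).
Qed.

(** If [e] is not a loop, the only basis of [[set e]] is itself. Contracting a loop amounts to
    deleting it, hence the first conjunct. *)
Lemma indep_minor_contract1 (M : matroid) (e : M) (I : {set M}) :
  e \notin I -> (e |: I \in indep M) =
  ([set e] \in indep M) &&
  ([disjoint I & [set e] :|: set0] &&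
    (val @^-1: I \in indep (minor [set e] set0))).
Proof.
move=> eI.
have dI : [disjoint I & [set e] :|: set0].
  by rewrite setU0 disjoint_sym disjoints1.
rewrite dI /=; apply/idP/andP=> [ieI|[ie /(minor_indep_disjoint dI)[B bB iIB]]].
  have ie : [set e] \in indep M by apply: indepS ieI; apply: subsetUl.
  split=> //; rewrite inE; apply/existsP; exists [set e].
  rewrite imset_val_preimset => [|x xI]; last by rewrite /= (disjointFr dI xI).
  rewrite setUC ieI andbT; apply/maxsetP; split=> /=; first by rewrite ie /=.
  by move=> B /andP[_ sB] sB'; apply/eqP; rewrite eqEsubset sB.
apply: indepS iIB; rewrite setUC setUS // sub1set; apply/negPn/negP=> eB.
have := basis_extend bB (set11 e) eB; case/maxsetP: bB => /= /andP[_].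
rewrite subset1 => /orP[/eqP eB'|/eqP -> _]; first by rewrite eB' set11 in eB.
by rewrite setU0 ie.
Qed.

(** * Exchange of elements with equal end-sets; clones *)

Lemma sparse_exchange (T V : finType) (a : T -> {set V}) (x y : T) (I : {set T}) :
  a x = a y -> x \notin I -> y \notin I -> sparse a (x |: I) = sparse a (y |: I).
Proof.
move=> axy xI yI.
have fixI z : z \in I -> tperm x y z = z.
  by move=> zI; rewrite tpermD //; [move: xI | move: yI]; apply: contraNneq => ->.
(* The transposition of [x] and [y] fixes [I] pointwise and preserves [a]. *)
have -> : y |: I = tperm x y @: (x |: I).
  rewrite imsetU1 tpermL; congr (_ |: _); apply/setP=> z.
  apply/idP/imsetP=> [zI|[t tI ->]].
    by exists z; rewrite ?fixI.
  by rewrite fixI.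
rewrite -sparse_comp; last exact: perm_inj.
by apply: eq_in_sparse => z _ /=; case: tpermP => // ->.
Qed.

(** Equivalently, every transposition of two elements of [X] is an automorphism of [M]. *)
Definition clones (M : matroid) (X : {set M}) : Prop :=
  forall x y, x \in X -> y \in X ->
  forall I : {set M}, x \notin I -> y \notin I ->
    (x |: I \in indep M) = (y |: I \in indep M).

(** Two nested pigeonholes, for [M \ e] and then for [M / e], each cost a factor [4 ^ rank M]; the
    predecessor discards [e]. *)
Lemma clones_exist (M : matroid) (m : nat) :
  excluded_minor M ->
  4 ^ rank M * (4 ^ rank M * m) < #|M|.-1 ->
  exists2 X : {set M}, clones X & m < #|X|.
Proof.
move=> [_ minorM] ltM.
have [e _] : exists e : M, true.
  case: (pickP (pred_of_set [set: M])) => [e _|h]; first by exists e.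
  by move: ltM; rewrite -cardsT (eq_card0 h).
have [|V [a [a2 aE]]] := @minor_represents M set0 [set e].
  apply: minorM; first by rewrite disjoints_subset sub0set.
  by rewrite set0U; apply/set0Pn; exists e; rewrite set11.
have [|W [b [b2 bE]]] := @minor_represents M [set e] set0.
  apply: minorM; first by rewrite disjoint_sym disjoints_subset sub0set.
  by rewrite setU0; apply/set0Pn; exists e; rewrite set11.
have [|A] := sparse_many_equal (X := [set~ e]) a2 (sparse_minor_rank aE)
  (m := 4 ^ rank M * m).
  by rewrite cardsC1.
set Y := [set x in _ | _] => ltY.
have [B ltX] := sparse_many_equal b2 (sparse_minor_rank bE) ltY.
exists [set x in Y | b x == B] => // x y.
rewrite !inE => /andP[/andP[xe /eqP ax] /eqP bx].
move=> /andP[/andP[ye /eqP ay] /eqP by_].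
(* Sets containing [e] are decided in [M / e], where [b] agrees on [x] and [y]; the others in
   [M \ e], where [a] does. *)
move=> I xI yI; have [eI|eI] := boolP (e \in I).
  have notin z : z != e -> z \notin I -> e \notin z |: I :\ e /\ z \notin I :\ e.
    by move=> ze zI; rewrite !inE eqxx orbF eq_sym ze (negPf zI) andbF.
  have [[ex xI'] [ey yI']] := (notin x xe xI, notin y ye yI).
  rewrite -(setD1K eI) !(setUCA _ [set e]) (indep_minor_contract1 ex).
  by rewrite (indep_minor_contract1 ey) -!bE (@sparse_exchange _ _ b x y) ?bx.
have notin z : z != e -> e \notin z |: I.
  by move=> ze; rewrite !inE eq_sym (negPf ze).
rewrite !(@indep_minor_delete1 M e) ?notin // -!aE.
by rewrite (@sparse_exchange _ _ a x y) // ax.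
Qed.

(** With more clones, [M] would be bicircular. The successor accounts for the clone [e] set apart
    before the pigeonhole. *)
Lemma clones_bounded (M : matroid) (X : {set M}) :
  excluded_minor M -> clones X -> #|X| <= (4 ^ rank M * rank M).+1.
Proof.
move=> [nbM minorM] clX; rewrite leqNgt; apply/negP=> ltX; apply: nbM.
have [X0|[e eX]] := set_0Vmem X; first by rewrite X0 cards0 in ltX.
have [|V [a [a2 aE]]] := @minor_represents M set0 [set e].
  apply: minorM; first by rewrite disjoints_subset sub0set.
  by rewrite set0U; apply/set0Pn; exists e; rewrite set11.
have [|A] := sparse_many_equal (X := X :\ e) a2 (sparse_minor_rank aE)
  (m := rank M).
  by move: ltX; rewrite (cardsD1 e) eX add1n ltnS.
set Y := [set x in _ | _] => ltY.
pose a' x := if x == e then A else a x.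
have aa' (I : {set M}) : e \notin I -> sparse a' I = sparse a I.
  move=> eI; apply: eq_in_sparse => x xI; rewrite /a'.
  by case: eqP => // xe; rewrite -xe xI in eI.
have exch (I : {set M}) : e \notin I -> #|I| <= rank M ->
    exists y, [/\ y \notin I, y != e, y \in X & a' y = A].
  move=> eI ltI.
  have /subsetPn[y] : ~~ (Y \subset I).
    apply/negP=> /subset_leq_card; rewrite leqNgt => /negP; apply.
    exact: leq_ltn_trans ltI ltY.
  rewrite !inE => /andP[/andP[ye yX] /eqP ay] yI.
  by exists y; split=> //; rewrite /a' (negPf ye).
have a'e : a' e = A by rewrite /a' eqxx.
have indepE (I : {set M}) : e \notin I -> (I \in indep M) = sparse a' I.
  by move=> eI; rewrite aa' // (indep_minor_delete1 eI) aE.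
have a'2 x : #|a' x| <= 2.
  rewrite /a'; case: eqP => // _; have : 0 < #|Y| by apply: leq_ltn_trans ltY.
  by rewrite card_gt0 => /set0Pn[y]; rewrite !inE => /andP[_ /eqP <-].
apply: (@represents_bicircular M V a'); split=> // I.
have [eI|eI] := boolP (e \in I); last exact: indepE.
have eI' : e \notin I :\ e by rewrite !inE eqxx.
rewrite -(setD1K eI).
have [ltI|leI] := leqP #|I :\ e| (rank M).
  (* Replacing [e] by a clone [y] outside [I] reduces to a set avoiding [e]. *)
  have [y [yI ye yX ay]] := exch _ eI' ltI.
  rewrite (clX e y) // (@sparse_exchange _ _ a' e y) ?ay //.
  by apply: indepE; rewrite !inE eqxx eq_sym (negPf ye).
(* Both sides are false here: [I :\ e] exceeds the rank, so it is dependent and, as it avoids [e],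
   not sparse. *)
have noI : I :\ e \notin indep M.
  by apply: contraL leI => /leq_rank; rewrite -leqNgt.
apply/idP/idP=> [iI|sI]; case/negP: noI.
  by apply: indepS iI; apply: subsetUr.
rewrite indepE //; apply/sparseP=> F sF; apply: (sparseP _ _ sI).
by apply: subset_trans sF (subsetUr _ _).
Qed.

Lemma excluded_minor_card (M : matroid) : excluded_minor M ->
  #|M| <= (4 ^ rank M * (4 ^ rank M * (4 ^ rank M * rank M).+1)).+1.
Proof.
move=> exM; rewrite leqNgt; apply/negP=> ltM.
(* [m] is the bound of [clones_bounded], which the clones found exceed. *)
have [|X clX] := @clones_exist M (4 ^ rank M * rank M).+1 exM.
  by rewrite -ltnS prednK // (leq_ltn_trans _ ltM).
by rewrite ltnNge clones_bounded.
Qed.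

(** * Finiteness of the matroids of bounded size, up to isomorphism *)

Section IndependenceAxioms.
Variables (T : finType) (S : {set {set T}}).

(** Boolean, so that it can be decided for each set system and has a unique proof. *)
Definition indep_axioms : bool :=
  [&& set0 \in S,
      [forall I : {set T}, forall J : {set T},
         (I \subset J) ==> (J \in S) ==> (I \in S)] &
      [forall I : {set T}, forall J : {set T},
         (I \in S) ==> (J \in S) ==> (#|I| < #|J|) ==>
         [exists x, (x \in J :\: I) && (x |: I \in S)]]].

Hypothesis axS : indep_axioms.

Let S0 : set0 \in S. Proof. by case/and3P: axS. Qed.

Let SS (I J : {set T}) : I \subset J -> J \in S -> I \in S.
Proof.
by case/and3P: axS => _ /'forall_forallP/(_ I J)/implyP h _ sIJ; apply/implyP/h.
Qed.

Let Saug (I J : {set T}) : I \in S -> J \in S -> #|I| < #|J| ->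
  exists2 x, x \in J :\: I & x |: I \in S.
Proof.
case/and3P: axS => _ _ /'forall_forallP/(_ I J) h iI iJ ltIJ.
by move: h; rewrite iI iJ ltIJ => /exists_inP.
Qed.

Definition matroid_of_indep : matroid := Matroid S0 SS Saug.

End IndependenceAxioms.

(** Default list entry for set systems that fail the axioms. *)
Definition rank0_matroid (T : finType) : matroid.
Proof.
apply: (@Matroid T [set set0]) => [|I J sIJ|I J]; rewrite ?inE //.
  by move=> /eqP J0; rewrite -subset0 -J0.
by move=> _ /eqP->; rewrite cards0.
Defined.

Lemma isomorphic_ordinal (M : matroid) (n : nat) : #|M| = n ->
  exists (S : {set {set 'I_n}}) (axS : indep_axioms S),
    isomorphic M (matroid_of_indep axS).
Proof.
move=> cM; case: _ / cM.
pose S := [set J : {set 'I_#|M|} | enum_rank @^-1: J \in indep M].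
have rK (x : M) y : (enum_rank x == y) = (x == enum_val y).
  exact: (can2_eq enum_rankK enum_valK).
have preim1 (y : 'I_#|M|) : enum_rank @^-1: [set y] = [set enum_val y] :> {set M}.
  by apply/setP=> x; rewrite !inE rK.
have axS : indep_axioms S.
  apply/and3P; split.
  - by rewrite inE preimset0 indep0.
  - apply/'forall_forallP=> I J; apply/implyP=> sIJ; apply/implyP.
    by rewrite !inE; apply: indepS; apply: preimsetS.
  apply/'forall_forallP=> I J; apply/implyP; rewrite inE => iI.
  apply/implyP; rewrite inE => iJ; apply/implyP => ltIJ.
  have [|x xJI ixI] := indep_augment iI iJ.
    by rewrite !on_card_preimset //; apply: onW_bij; apply: enum_rank_bij.
  apply/exists_inP; exists (enum_rank x); first by move: xJI; rewrite !inE.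
  by rewrite inE preimsetU preim1 enum_rankK.
exists S, axS, enum_rank; first exact: enum_rank_bij.
move=> I; rewrite inE; have -> // : enum_rank @^-1: (enum_rank @: I) = I.
by apply/setP=> x; rewrite inE (mem_imset _ _ enum_rank_inj).
Qed.

(** Up to isomorphism a matroid on [k] elements is a set system on ['I_k], and the pairs of such a
    [k <= N] and a set system form a finite type. *)
Lemma finitely_many_matroids (N : nat) :
  exists (n : nat) (L : 'I_n -> matroid),
    forall M : matroid, #|M| <= N -> exists i : 'I_n, isomorphic M (L i).
Proof.
pose I : finType := {k : 'I_N.+1 & {set {set 'I_k}}}.
pose mat (i : I) : matroid :=
  if decP (@idP (indep_axioms (tagged i))) is left axS then matroid_of_indep axS
  else rank0_matroid 'I_0.
exists #|I|, (mat \o enum_val) => M leM.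
have [S [axS isoM]] := @isomorphic_ordinal M (Ordinal (leM : #|M| < N.+1)) erefl.
exists (enum_rank (Tagged (fun k : 'I_N.+1 => {set {set 'I_k}}) S)).
rewrite /= enum_rankK /mat /=; case: decP => [axS'|/(_ axS) //].
by rewrite (bool_irrelevance axS' axS).
Qed.

Theorem theorem7p1 :
  exists (n : nat) (L : 'I_n -> matroid),
    forall M : matroid, excluded_minor M -> (rank M < 10)%N ->
      exists i : 'I_n, isomorphic M (L i).
Proof.
pose bound r := (4 ^ r * (4 ^ r * (4 ^ r * r).+1)).+1.
(* The maximum over the ten possible ranks bounds the size of every [M] at once. *)
have [n [L covL]] := finitely_many_matroids (\max_(r < 10) bound r).
exists n, L => M exM ltM; apply: covL.
apply: leq_trans (excluded_minor_card exM) _.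
exact: (leq_bigmax (Ordinal ltM)).
Qed.
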